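(* Let $d\ge 2$ and let $f_d(x,y) = \sum_{i=0}^{d}\sum_{j=0}^{d} A_{(i,j)} x^i y^j \in \mathbb{C}[x,y]$ be a degree $d$ polynomial correspondence. Then $f_d$ is a map of $d$-tuples on the Riemann sphere if and only if one of the following conditions is true: (1) $f_d(x,y)$ is of the form $f_d(x,y) = [g_k(x,y)]^{d/k}$ where $k\mid d$, $k\neq d$, and $g_k\in\mathbb{C}[x,y]$ is a map of $k$-tuples. (2) The matrix of coefficients of $f_d$ has rank $2$, i.e., $$\operatorname{rank}\begin{pmatrix} A_{(d,d)} & A_{(d,d-1)} & \cdots & A_{(d,0)} \\ A_{(d-1,d)} & A_{(d-1,d-1)} & \cdots & A_{(d-1,0)} \\ \vdots & \vdots & & \vdots \\ A_{(0,d)} & A_{(0,d-1)} & \cdots & A_{(0,0)} \end{pmatrix}_{(d+1)\times(d+1)} = 2.$$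
   Context: $\widehat{\mathbb{C}} = \mathbb{C}\cup\{\infty\}$ is the Riemann sphere; $\widehat{\mathbb{C}}_x$ and $\widehat{\mathbb{C}}_y$ denote the copies in which $x$ and $y$ range. Degree $n$ polynomial correspondence ($n\ge 1$): a polynomial $f(x,y)=\sum_{0\le i,j\le n}A_{(i,j)}x^iy^j\in\mathbb{C}[x,y]$, of degree $n$ in each of the two variables, such that (1) $f(x,\cdot)$ and $f(\cdot,y)$ are generically $n$-valued (counting multiplicity), and (2) the biprojective completion $\Gamma_f$ of $\{f=0\}$ in $\widehat{\mathbb{C}}_x\times\widehat{\mathbb{C}}_y$ (the zero set of the bihomogenisation of $f$ of bidegree $(n,n)$) has no irreducible component of the form $\{a\}\times\widehat{\mathbb{C}}_y$ or $\widehat{\mathbb{C}}_x\times\{a\}$ with $a\in\widehat{\mathbb{C}}$. Map of $n$-tuples: let $f$ be a degree $n$ polynomial correspondence and $\Pi_x,\Pi_y$ the projections of $\Gamma_f$ to $\widehat{\mathbb{C}}_x,\widehat{\mathbb{C}}_y$. For $x_1\in\widehat{\mathbb{C}}_x$, let $y_1(x_1),\dots,y_n(x_1)$ be the points of $\Pi_y(\Pi_x^{-1}\{x_1\}\cap\Gamma_f)$ listed according to intersection multiplicity (equivalently, multiplicity as zeros of the bihomogenised $f(x_1,\cdot)$), and for each $j$ let $\{x_1,x_2(y_j(x_1)),\dots,x_n(y_j(x_1))\}$ be the list of points of $\Pi_x(\Pi_y^{-1}\{y_j(x_1)\}\cap\Gamma_f)$, repeated according to multiplicity. For $y_1\in\widehat{\mathbb{C}}_y$,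 define the points $x_j(y_1)$ and the lists $\{y_1,y_2(x_j(y_1)),\dots,y_n(x_j(y_1))\}$ in the same way with the roles of $x$ and $y$ interchanged. $f$ is a map of $n$-tuples if for each $x_1\in\widehat{\mathbb{C}}_x$ the $n$ lists $\{x_1,x_2(y_j(x_1)),\dots,x_n(y_j(x_1))\}$, $j=1,\dots,n$, coincide, and for each $y_1\in\widehat{\mathbb{C}}_y$ the $n$ lists $\{y_1,y_2(x_j(y_1)),\dots,y_n(x_j(y_1))\}$, $j=1,\dots,n$, coincide (lists being taken with multiplicity, irrespective of order). *)

(* Defs.v *)
From mathcomp Require Import all_boot all_order all_algebra.
From mathcomp Require Import boolp classical_sets reals.
From mathcomp Require Import complex.

Set Implicit Arguments.
Unset Strict Implicit.
Unset Printing Implicit Defensive.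

Import GRing.Theory.
Local Open Scope ring_scope.
Local Open Scope classical_set_scope.

(* The complex field is R[i] with R : realType.  A polynomial f(x, y) is an
   element of {poly {poly R[i]}} with x the outer and y the inner variable, as
   in polyXY: the coefficient of x^i y^j is f`_i`_j, f(a, .) is f.[a%:P], and
   swapXY exchanges the two variables. *)

Section Correspondences.
Variable R : realType.
Local Notation C := R[i].
Implicit Types (f g h : {poly {poly C}}) (p : {poly C}) (m n : nat).

(* The Riemann sphere is option C, None being the point at infinity. *)
Definition hcoord (a : option C) : C * C :=
  if a is Some z then (z, 1) else (1, 0).

(* The bihomogenisation of h of bidegree (m, n), evaluated at homogeneous
   coordinates of a in the first factor, and dehomogenised in the second
   factor (as a binary form of degree n). *)
Definition slice m h (a : option C) : {poly C} :=
  \sum_(i < m.+1) ((hcoord a).1 ^+ i * (hcoord a).2 ^+ (m - i)) *: h`_i.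

(* Coefficients of h beyond bidegree (m, n) are ignored, so that h ranges over
   all bihomogeneous forms of bidegree (m, n). *)
Definition bihom m n h (a b : option C) : C :=
  \sum_(j < n.+1)
    (slice m h a)`_j * ((hcoord b).1 ^+ j * (hcoord b).2 ^+ (n - j)).

Definition Gamma n f : set (option C * option C) :=
  [set P | bihom n n f P.1 P.2 = 0].

(* Zariski topology on the product of two spheres. *)
Definition zariski_closed (Z : set (option C * option C)) : Prop :=
  exists S : set (nat * nat * {poly {poly C}}),
    Z = [set P | forall m n h, S (m, n, h) -> bihom m n h P.1 P.2 = 0].

Definition zariski_irreducible (Z : set (option C * option C)) : Prop :=
  Z !=set0 /\
  forall A B, zariski_closed A -> zariski_closed B ->
    Z `<=` A `|` B -> Z `<=` A \/ Z `<=` B.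

Definition irreducible_component (W Z : set (option C * option C)) : Prop :=
  [/\ W `<=` Z, zariski_irreducible W &
      forall W', W' `<=` Z -> zariski_irreducible W' -> W `<=` W' -> W' = W].

(* The zeros of p in C, listed with multiplicity (for p != 0). *)
Definition zeros p : seq C := sval (closed_field_poly_normal p).

(* For p != 0 of degree at most n, the zeros on the sphere, with multiplicity,
   of the binary form of degree n with dehomogenisation p: infinity is a zero
   of order n - deg p. *)
Definition sphere_zeros n p : seq (option C) :=
  map Some (zeros p) ++ nseq (n.+1 - size p) None.

(* The points of Gamma n f above a, projected to the second factor and listed
   with multiplicity; fibre n (swapXY f) b is the list of points of the first
   factor corresponding to b. *)
Definition fibre n f (a : option C) : seq (option C) :=
  sphere_zeros n (slice n f a).

Definition generically_valued n f : Prop :=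
  exists s : seq C, forall a, a \notin s ->
    f.[a%:P] != 0 /\ size (zeros f.[a%:P]) = n.

Record polynomial_correspondence n f : Prop := PolynomialCorrespondence {
  corr_pos : (0 < n)%N;
  corr_degx : size f = n.+1;
  corr_degy : sizeY f = n.+1;
  corr_valx : generically_valued n f;
  corr_valy : generically_valued n (swapXY f);
  corr_vert : forall a : option C,
    ~ irreducible_component ([set a] `*` [set: option C]) (Gamma n f);
  corr_horiz : forall a : option C,
    ~ irreducible_component ([set: option C] `*` [set a]) (Gamma n f)
}.

Definition lists_coincide n f : Prop :=
  forall (x y y' : option C), y \in fibre n f x -> y' \in fibre n f x ->
    perm_eq (fibre n (swapXY f) y) (fibre n (swapXY f) y').

Definition map_of_tuples n f : Prop :=
  [/\ polynomial_correspondence n f, lists_coincide n f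
    & lists_coincide n (swapXY f)].

Definition coef_matrix n f : 'M[C]_n.+1 :=
  \matrix_(r < n.+1, c < n.+1) f`_(n - r)`_(n - c).

End Correspondences.

(* Main.v *)
Require Import Defs.
From mathcomp Require Import all_boot all_order all_algebra.
From mathcomp Require Import boolp classical_sets reals ring.
From mathcomp Require Import complex.

Set Implicit Arguments.
Unset Strict Implicit.
Unset Printing Implicit Defensive.

Import GRing.Theory Num.Theory.
Local Open Scope ring_scope.

(** Write f(x, .) and f(., y) for the two families of one-variable polynomials
    cut out of f.  When no sphere {a} x S or S x {a} lies in the zero set, none
    of them vanishes identically, and two lists of zeros coincide exactly when
    the corresponding polynomials are proportional.  So f is a map of tuples
    when f(., y) and f(., y') are proportional as soon as y and y' lie over a
    common x, and symmetrically.

    If f = g^m, every list of f is the list of g repeated m times, and f and g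
    are maps of tuples together ([map_of_tuples_power]).  If the coefficient
    matrix M has rank 2, the f(., y) span a plane; those vanishing at a given x
    form a line of that plane, since f(x, .) is not zero, so they are
    proportional ([lists_coincide_of_rank2]).

    Conversely let f be a map of tuples.  At all but finitely many zeros (x, y)
    of f, the multiplicity of y in f(x, .) equals that of x in f(., y): near
    such a zero f is, up to a nonvanishing factor, a power of a polynomial which
    vanishes to order 1 along either axis ([agree_multiplicity]).  Over a
    generic x the second multiplicity does not depend on y, because the lists
    coincide; hence f(x, .) has all its zeros of one multiplicity m, i.e. is an
    m-th power.  The same m occurs for infinitely many x, and then for
    infinitely many y.

    - If m = 1, fix two of the polynomials, P = f(x1, .) and Q = f(x2, .).  For
      x and y0 in its fibre, the combination P(y0) Q - Q(y0) P vanishes at y0,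
      hence on the whole fibre of x, whose n points are distinct; it is
      therefore proportional to f(x, .).  So infinitely many, hence all, of
      the f(x, .) lie in the pencil of P and Q, and M has rank 2
      ([pencil_of_simple_fibres], [rank2_of_pencil]).
    - If m > 1, then f is itself an m-th power, being one on infinitely many
      slices in both directions ([power_of_slices]). *)

(** * Generic and infinitely recurring properties of scalars *)

Section Generic.
Variable C : closedFieldType.
Implicit Types (P Q : C -> Prop) (s : seq C).

Definition generically P := exists s, forall x, x \notin s -> P x.

(** Infinitude, as the failure of every finite list to exhaust P. *)
Definition frequently P := forall s, exists2 x, x \notin s & P x.

Lemma generically_and P Q :
  generically P -> generically Q -> generically (fun x => P x /\ Q x).
Proof.
move=> [s sP] [t tQ]; exists (s ++ t) => x.
by rewrite mem_cat negb_or => /andP[xs xt]; split; [exact: sP | exact: tQ].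
Qed.

Lemma generically_impl P Q :
  (forall x, P x -> Q x) -> generically P -> generically Q.
Proof. by move=> PQ [s sP]; exists s => x /sP /PQ. Qed.

Lemma generically_all (T : eqType) (r : seq T) (P : T -> C -> Prop) :
    (forall t, t \in r -> generically (P t)) ->
  generically (fun x => forall t, t \in r -> P t x).
Proof.
elim: r => [|t r IHr] Pr; first by exists [::].
have Pt := Pr t (mem_head t r).
have := IHr (fun u ur => Pr u (mem_behead (s := t :: r) ur)).
move=> /(generically_and Pt); apply: generically_impl => x [Ptx Prx] u.
by rewrite inE => /predU1P[->|/Prx].
Qed.

Lemma generically_notin s : generically (fun x => x \notin s).
Proof. by exists s. Qed.

Lemma frequently_generically P Q :
  frequently P -> generically Q -> frequently (fun x => P x /\ Q x).
Proof.
move=> fP [s sQ] t; have [x] := fP (s ++ t).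
rewrite mem_cat negb_or => /andP[xs xt] Px; exists x => //.
by split=> //; exact: sQ.
Qed.

Lemma generically_frequently P : generically P -> frequently P.
Proof.
move=> [s sP] t.
have /closed_nonrootP[x] : \prod_(z <- s ++ t) ('X - z%:P) != 0.
  by rewrite monic_neq0 // monic_prod_XsubC.
rewrite root_prod_XsubC mem_cat negb_or => /andP[xs xt].
by exists x => //; exact: sP.
Qed.

Lemma frequently_pigeonhole n (P : nat -> C -> Prop) :
    frequently (fun x => exists2 m, (m < n)%N & P m x) ->
  exists2 m, (m < n)%N & frequently (P m).
Proof.
elim: n => [|n IHn] fP; first by have [x _ []] := fP [::].
have [fPn|nfPn] := pselect (frequently (P n)); first by exists n.
have [|m mn fPm] := IHn; last by exists m => //; exact: leqW.
have gPn : generically (fun x => ~ P n x).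
  apply: contrapT => ngPn; apply: nfPn => s; apply: contrapT => nPs.
  by apply: ngPn; exists s => x xs Px; apply: nPs; exists x.
move=> s; have [x xs [[m mn Pmx] nPx]] := frequently_generically fP gPn s.
exists x => //; exists m => //; move: mn; rewrite ltnS leq_eqVlt.
by case/predU1P => // emn; case: nPx; rewrite -emn.
Qed.

Lemma generically_nonroot (p : {poly C}) :
  p != 0 -> generically (fun x => ~~ root p x).
Proof.
move=> p0; have [r def_p] := closed_field_poly_normal p; exists r => x xr.
by rewrite def_p rootZ ?lead_coef_eq0 // root_prod_XsubC.
Qed.

Lemma generically_horner_neq0 (f : {poly {poly C}}) :
  f != 0 -> generically (fun x => f.[x%:P] != 0).
Proof.
rewrite -(swapXY_eq0 f) -lead_coef_eq0 => /generically_nonroot.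
apply: generically_impl => x; apply: contraNneq => fx0.
have := congr1 (fun p : {poly C} => p`_(size (swapXY f)).-1) fx0.
by rewrite horner_polyC coef_map coef0 /= /horner_eval /root => ->.
Qed.

Lemma frequently_horner_eq0 (f : {poly {poly C}}) :
  frequently (fun x => f.[x%:P] = 0) -> f = 0.
Proof.
move=> fr; apply/eqP; apply: contraT => /generically_horner_neq0.
by move=> /(frequently_generically fr)/(_ [::])[x _ [->]]; rewrite eqxx.
Qed.

End Generic.

(** * Multiplicities along the two axes *)

Section Agree.
Variable C : numClosedFieldType.
Implicit Types (f g : {poly {poly C}}) (p q u v c : {poly C}) (x y : C).

Definition multiplicities_agree f := exists A B : seq C,
  forall x y, x \notin A -> y \notin B ->
  [/\ f.[x%:P] != 0, (swapXY f).[y%:P] != 0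
    & mup y f.[x%:P] = mup x (swapXY f).[y%:P]].

Lemma root_swapXY f x y :
  root (swapXY f).[y%:P] x = root f.[x%:P] y.
Proof. by rewrite /root horner2_swapXY. Qed.

Lemma agreeM f g : multiplicities_agree f -> multiplicities_agree g ->
  multiplicities_agree (f * g).
Proof.
move=> [A [B AB]] [A' [B' AB']]; exists (A ++ A'), (B ++ B') => x y.
rewrite !mem_cat !negb_or => /andP[xA xA'] /andP[yB yB'].
have [fx fy fxy] := AB x y xA yB; have [gx gy gxy] := AB' x y xA' yB'.
by rewrite rmorphM /= !hornerM !mulf_neq0 ?mupM // fxy gxy.
Qed.

(** Multiplicities being additive, agreement passes to cofactors.  This lets a
    polynomial be factored up to a coefficient in one variable, as
    pseudo-division does, with no appeal to the lemma of Gauss. *)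
Lemma agree_divr f g : multiplicities_agree (f * g) ->
  multiplicities_agree f -> multiplicities_agree g.
Proof.
move=> [A [B AB]] [A' [B' AB']]; exists (A ++ A'), (B ++ B') => x y.
rewrite !mem_cat !negb_or => /andP[xA xA'] /andP[yB yB'].
have [fx fy fxy] := AB' x y xA' yB'; have := AB x y xA yB.
rewrite rmorphM /= !hornerM !mulf_eq0 !negb_or => -[/andP[_ gx] /andP[_ gy]].
by rewrite !mupM // fxy => /addnI->.
Qed.


Lemma mup_simple_root p x :
  p != 0 -> root p x -> ~~ root p^`() x -> mup x p = 1%N.
Proof.
move=> p0 px p'x; apply/eqP; rewrite eqn_leq mup_geq // mup_leq //.
rewrite dvdp_XsubCl px andbT; apply: contra p'x => /dvdpP[q ->].
by rewrite expr2 mulrA derivM rootE !hornerE subrr !mulr0 !mul0r addr0.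
Qed.

Lemma horner_deriv_swapXY f y :
  (swapXY f^`()).[y%:P] = ((swapXY f).[y%:P])^`().
Proof. by rewrite !horner_swapXY deriv_map. Qed.

Lemma agree_simple_roots f :
  f != 0 ->
  (exists A B : seq C, forall x y, x \notin A -> y \notin B ->
     root f.[x%:P] y -> ~~ root (f.[x%:P])^`() y /\
                        ~~ root ((swapXY f).[y%:P])^`() x) ->
  multiplicities_agree f.
Proof.
move=> f0 [A [B AB]].
have [A' fA'] := generically_horner_neq0 f0.
have [B' fB'] : generically (fun y => (swapXY f).[y%:P] != 0).
  by apply: generically_horner_neq0; rewrite swapXY_eq0.
exists (A ++ A'), (B ++ B') => x y; rewrite !mem_cat !negb_or.
move=> /andP[xA xA'] /andP[yB yB']; split; rewrite ?fA' ?fB' //.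
have [rf|nrf] := boolP (root f.[x%:P] y); last first.
  by rewrite !mupNroot // root_swapXY.
have [fx fy] := AB x y xA yB rf.
by rewrite !mup_simple_root ?fA' ?fB' ?root_swapXY.
Qed.

Lemma agree_polyC c : c != 0 -> multiplicities_agree c%:P.
Proof.
move=> c0; apply: agree_simple_roots; first by rewrite polyC_eq0.
have [B cB] := generically_nonroot c0; exists [::], B => x y _ /cB.
by rewrite hornerC => /negPf->.
Qed.

(** A Bezout relation over C[y] is an equality u f + v g = b with b a nonzero
    polynomial in y alone, so common zeros lie over the zeros of b. *)
Lemma coprimep_no_common_root f g : coprimep f g ->
  exists B : seq C, forall x y, y \notin B ->
    root f.[x%:P] y -> ~~ root g.[x%:P] y.
Proof.
case/Bezout_coprimepP => -[u v] /= /eqpP[[a b] /= /andP[_ b0] e].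
have [B bB] := generically_nonroot b0; exists B => x y /bB.
move=> nby /rootP fy; apply: contra nby => /rootP gy.
have := congr1 (fun h : {poly {poly C}} => h.[x%:P].[y]) e.
rewrite !hornerE fy gy !mulr0.
by rewrite addr0 mulr0 => e0; rewrite /root -e0.
Qed.

(** A nonzero solution u of the linear equation c u' = q u cannot vanish where
    c does not: its order there would be one more than the order of u'. *)
Lemma no_common_root_deriv u c q y : u != 0 -> root u y -> ~~ root c y ->
  c * u^`() != q * u.
Proof.
move=> u0 uy cy.
have [m [v]] := multiplicity_XsubC u y; rewrite u0 /= => vy def_u.
case: m => [|m] in def_u; first by rewrite def_u mulr1 (negPf vy) in uy.
apply: contraNneq cy => e; rewrite /root.
have : ('X - y%:P) ^+ m *
    (c * (v^`() * ('X - y%:P) + v * m.+1%:R) - q * v * ('X - y%:P)) = 0.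
  have: c * u^`() - q * u = 0 by rewrite e subrr.
  rewrite def_u derivM deriv_exp derivXsubC -pred_Sn -mulr_natr => <-.
  by rewrite exprSr; ring.
move=> /eqP; rewrite mulf_eq0 expf_eq0 polyXsubC_eq0 andbF /= => /eqP.
move=> /(congr1 (horner^~ y)); rewrite !hornerE subrr !mulr0 add0r subr0.
rewrite -polyC_natr hornerC => /eqP; rewrite !mulf_eq0 pnatr_eq0 orbF.
by case/orP=> // vy0; rewrite /root vy0 in vy.
Qed.

(** A proper factor g gives c f = h g for some c in C[y], with g and h both of
    smaller degree in x. *)
Lemma agree_dvdp f g : f != 0 -> g %| f -> (1 < size g < size f)%N ->
  (forall h : {poly {poly C}}, h != 0 -> (size h < size f)%N ->
     multiplicities_agree h) ->
  multiplicities_agree f.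
Proof.
move=> f0; rewrite Pdiv.Idomain.dvdp_eq; set c := _ ^+ _; set h := f %/ g.
rewrite -mul_polyC => /eqP e /andP[g1 gf] IH.
have g0 : g != 0 by rewrite -size_poly_gt0 ltnW.
have c0 : c != 0 by rewrite expf_neq0 ?lead_coef_eq0.
have h0 : h != 0.
  apply: contra_neq f0 => h0; move/eqP: e.
  by rewrite h0 mul0r mulf_eq0 polyC_eq0 (negPf c0) => /eqP.
have hf : (size h < size f)%N.
  have : size (c%:P * f) = size f by rewrite mul_polyC size_scale.
  rewrite e size_mul // => <-.
  by case: (size g) g1 => [|[|n]] //= _; rewrite !addnS /= leq_addr.
apply: (@agree_divr c%:P); last exact: agree_polyC.
by rewrite e; apply: agreeM; apply: IH.
Qed.

(** Induction on the degree in x.  A common factor of f with its derivative in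
    x, or a proper one with its derivative in y, splits f.  If both derivatives
    are coprime to f, generic zeros are simple in both directions.  If f divides
    its derivative in y, then for each x the polynomial f(x, .) solves an
    equation c u' = q u, so that f has no generic zero at all. *)
Lemma agree_multiplicity f : f != 0 -> multiplicities_agree f.
Proof.
have [n] := ubnP (size f); elim: n f => // n IHn f; rewrite ltnS => fn f0.
have IH (h : {poly {poly C}}) :
    h != 0 -> (size h < size f)%N -> multiplicities_agree h.
  by move=> h0 hf; apply: IHn => //; apply: leq_trans fn.
have [f1|f1] := leqP (size f) 1.
  rewrite (size1_polyC f1) in f0 *; apply: agree_polyC.
  by rewrite polyC_eq0 in f0.
have f'0 : f^`() != 0.
  apply: contraTneq f1 => /(congr1 (fun h : {poly {poly C}} => h`_(size f).-2)).
  rewrite coef_deriv coef0 -ltnNge => /eqP; rewrite -mulr_natr mulf_eq0.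
  rewrite -polyC_natr polyC_eq0 pnatr_eq0 orbF.
  case fs: (size f) => [|[|n']] //; move: f0.
  by rewrite -lead_coef_eq0 lead_coefE fs => /negPf->.
have size_gcd_gt1 g : ~ coprimep f g -> (1 < size (gcdp f g))%N.
  move=> ncop; rewrite ltn_neqAle eq_sym lt0n size_poly_eq0 gcdp_eq0.
  by rewrite (negPf f0) andbT; exact/negP.
have [cop_f|/negP ncop_f] := boolP (coprimep f f^`()); last first.
  apply: (agree_dvdp f0 (dvdp_gcdl f f^`()) _ IH).
  rewrite size_gcd_gt1 //=; apply: leq_ltn_trans (leq_gcdpr _ f'0) _.
  exact: lt_size_deriv.
(* fy is the derivative of f in the inner variable y. *)
pose fy := swapXY (swapXY f)^`().
have fyE x : fy.[x%:P] = (f.[x%:P])^`().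
  by rewrite /fy horner_deriv_swapXY swapXYK.
have [B BP] := coprimep_no_common_root cop_f.
have [cop_fy|/negP/size_gcd_gt1 g_gt1] := boolP (coprimep f fy).
  have [B' BP'] := coprimep_no_common_root cop_fy.
  apply: agree_simple_roots => //; exists [::], (B ++ B') => x y _.
  rewrite mem_cat negb_or => /andP[yB yB'] rf; rewrite -fyE BP' //.
  by rewrite -horner_deriv_swapXY root_swapXY BP.
have [g_lt|g_ge] := ltnP (size (gcdp f fy)) (size f).
  by apply: (agree_dvdp f0 (dvdp_gcdl f fy) _ IH); rewrite g_gt1.
have f_dvd : f %| fy.
  have: gcdp f fy %= f.
    by rewrite -(dvdp_size_eqp (dvdp_gcdl f fy)) eqn_leq g_ge leq_gcdpl.
  by move=> /eqp_dvdl <-; exact: dvdp_gcdr.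
move: f_dvd; rewrite Pdiv.Idomain.dvdp_eq; set c := _ ^+ _ => /eqP e.
have c0 : c != 0 by rewrite expf_neq0 ?lead_coef_eq0.
have [A fA] := generically_horner_neq0 f0.
have [B' cB] := generically_nonroot c0.
apply: agree_simple_roots => //; exists A, B' => x y /fA fx0 /cB cy rf.
have /eqP[] := no_common_root_deriv (fy %/ f).[x%:P] fx0 rf cy.
by rewrite -fyE -hornerZ e hornerM.
Qed.

End Agree.

Lemma frequently_injective (C : closedFieldType) (P : C -> Prop) :
  frequently P -> exists2 x : nat -> C, injective x & forall i, P (x i).
Proof.
move=> fP.
have /choice[next nextP] (s : seq C) : exists x, x \notin s /\ P x.
  by have [x xs Px] := fP s; exists x.
pose prefix n := iter n (fun s => next s :: s) [::].
have prefixE i j : (i < j)%N -> next (prefix i) \in prefix j.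
  elim: j => // j IHj; rewrite ltnS leq_eqVlt inE => /predU1P[->|/IHj->].
    by rewrite eqxx.
  by rewrite orbT.
exists (fun n => next (prefix n)) => [i j e|i]; last first.
  by have [] := nextP (prefix i).
have notin k : (next (prefix k) \in prefix k) = false.
  by have [/negPf] := nextP (prefix k).
by have [/prefixE|/prefixE|//] := ltngtP i j; rewrite ?e ?notin // -e notin.
Qed.

(** * Powers and pencils recognised on slices *)

Section Powers.
Variable C : numClosedFieldType.
Implicit Types (f g : {poly {poly C}}) (p q r : {poly C}) (x y : C).
Implicit Types (m n : nat).

Lemma eqp_mup p q x : p != 0 -> p %= q -> mup x p = mup x q.
Proof.
move=> p0 pq; have q0 : q != 0.
  by rewrite -size_poly_eq0 -(eqp_size pq) size_poly_eq0.
apply/eqP; rewrite eqn_leq mup_geq // -(eqp_dvdr _ pq) -mup_geq // leqnn /=.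
by rewrite mup_geq // (eqp_dvdr _ pq) -mup_geq.
Qed.

Lemma power_of_uniform_mup m p : (0 < m)%N -> p != 0 ->
  (forall y, root p y -> mup y p = m) -> exists r, p = r ^+ m.
Proof.
move=> m0 p0 pm; have [s def_p] := closed_field_poly_normal p.
have lp0 : lead_coef p != 0 by rewrite lead_coef_eq0.
exists ((m.-root (lead_coef p))%:P * \prod_(z <- undup s) ('X - z%:P)).
rewrite exprMn -polyC_exp rootCK // mul_polyC -prodrXl.
rewrite {1}def_p -[in LHS]prodr_undup_exp_count; congr (_ *: _).
apply: eq_big_seq => z; rewrite mem_undup => zs; congr (_ ^+ _).
rewrite -(pm z); last by rewrite def_p rootZ // root_prod_XsubC.
rewrite -(mu_prod_XsubC z s); apply: eqp_mup.
  exact/monic_neq0/monic_prod_XsubC.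
by rewrite eqp_sym def_p eqp_scale.
Qed.

(** Finitely many factors account for all ambiguity in extracting an m-th
    root. *)
Lemma roots_of_unity m : (0 < m)%N ->
  exists s : seq C,
    forall x y, x ^+ m = y ^+ m -> exists2 z, z \in s & x = z * y.
Proof.
move=> m0; have p0 : 'X^m - 1 != 0 :> {poly C}.
  by rewrite -size_poly_gt0 size_XnsubC.
have [s def_p] := closed_field_poly_normal ('X^m - 1 : {poly C}); exists s.
have mem_s z : z ^+ m = 1 -> z \in s.
  move=> zm; rewrite -root_prod_XsubC.
  rewrite -(rootZ _ _ (_ : lead_coef ('X^m - 1) != 0)).
    by rewrite -def_p rootE !hornerE zm subrr.
  by rewrite lead_coef_eq0.
move=> x y xy; have [y0|y0] := eqVneq y 0.
  exists 1; first by rewrite mem_s ?expr1n.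
  apply/eqP; rewrite mul1r y0 -[x == 0]andTb -m0 -expf_eq0.
  by rewrite xy y0 expr0n eqn0Ngt m0.
exists (x / y); last by rewrite divfK.
by apply: mem_s; rewrite exprMn exprVn xy divff // expf_neq0.
Qed.

(** Fix enough points x_i and m-th roots r_i of f(x_i, .).  For infinitely many
    y, f(., y) is the m-th power of some q with q(x_i) = zeta_i r_i(y), the
    zeta_i being roots of unity; by Lagrange interpolation q is then the slice
    at y of g_zeta = \sum_i zeta_i L_i(x) r_i(y).  There are finitely many
    choices of zeta, so f - g_zeta^m vanishes on infinitely many slices for one
    of them, and f = g_zeta^m. *)
Lemma power_of_slices m f : (0 < m)%N ->
    frequently (fun x => exists r, f.[x%:P] = r ^+ m) ->
    frequently (fun y => exists r, (swapXY f).[y%:P] = r ^+ m) ->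
  exists g, f = g ^+ m.
Proof.
move=> m0 fx fy; have [->|f0] := eqVneq f 0.
  by exists 0; rewrite expr0n eqn0Ngt m0.
have [x x_inj /choice[r rP]] := frequently_injective fx.
have [s sP] := roots_of_unity m0.
pose K := size f; have K0 : (0 < K)%N by rewrite size_poly_gt0.
pose L (i : 'I_K) : {poly C} := tnth (lagrange K x) i.
pose g (z : {ffun 'I_K -> 'I_(size s)}) : {poly {poly C}} :=
  \sum_(i < K) map_poly polyC (s`_(z i) *: r i) * (L i)%:P.
(* A vanishing product over all choices of roots of unity does the work of the
   pigeonhole principle. *)
suff /eqP/prodf_eq0[z _] : \prod_z (swapXY f - g z ^+ m) = 0.
  rewrite subr_eq0 => /eqP e; exists (swapXY (g z)).
  by rewrite -rmorphXn /= -e swapXYK.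
apply: frequently_horner_eq0 => t; have [y yt [q qP]] := fy t; exists y => //.
rewrite horner_prod; apply/eqP/prodf_eq0.
have qx i : q.[x i] ^+ m = (r i).[y] ^+ m.
  by rewrite -!horner_exp -qP -rP horner2_swapXY.
have /choice[z zP] (i : 'I_K) :
    exists k : 'I_(size s), q.[x i] = s`_k * (r i).[y].
  have [z zs ->] := sP _ _ (qx i).
  have zi : (index z s < size s)%N by rewrite index_mem.
  by exists (Ordinal zi); rewrite /= nth_index.
exists [ffun i => z i] => //; rewrite hornerD hornerN horner_exp subr_eq0 qP.
have size_q : (size q <= K)%N.
  have [->|q0] := eqVneq q 0; first by rewrite size_poly0.
  have qm0 : q ^+ m != 0 by rewrite expf_neq0.
  have: (size (q ^+ m) <= K)%N.
    by rewrite -qP (leq_trans (max_size_evalC _ _)) // sizeYE swapXYK.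
  apply: leq_trans; rewrite -(prednK (_ : 0 < size q))%N ?size_poly_gt0 //.
  rewrite -(prednK (_ : 0 < size (q ^+ m)))%N ?size_poly_gt0 // size_exp ltnS.
  by rewrite leq_pmulr.
rewrite {1}(lagrange_gen K0 x_inj size_q) horner_sum; apply/eqP; congr (_ ^+ _).
apply: eq_bigr => i _; rewrite hornerM hornerC horner_map hornerZ ffunE.
by rewrite /= zP.
Qed.

(** For y0 in the fibre of x, the member of the pencil of f(x1, .) and f(x2, .)
    that vanishes at y0 vanishes on the whole fibre of x, because the f(., y)
    with y in that fibre are proportional.  As f(x, .) has simple zeros, it
    divides this member, and the degrees agree. *)
Lemma pencil_of_simple_fibres n f :
    (0 < n)%N -> (sizeY f <= n.+1)%N ->
    (forall y, (swapXY f).[y%:P] != 0) ->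
    (forall x y y', root f.[x%:P] y -> root f.[x%:P] y' ->
       (swapXY f).[y%:P] %= (swapXY f).[y'%:P]) ->
    frequently (fun x => size f.[x%:P] = n.+1 /\
       forall y, root f.[x%:P] y -> mup y f.[x%:P] = 1%N) ->
  exists x1 x2 y1, [/\ f.[x1%:P] != 0, root f.[x1%:P] y1, ~~ root f.[x2%:P] y1
    & frequently (fun x => exists a b,
        f.[x%:P] = a *: f.[x1%:P] + b *: f.[x2%:P])].
Proof.
move=> n0 fY fy0 fy fx.
have exroot x : size f.[x%:P] = n.+1 -> exists y, root f.[x%:P] y.
  by move=> fxn; apply/closed_rootP; rewrite fxn -(prednK n0).
have [x1 _ [fx1 _]] := fx [::].
have [y1 rt1] := exroot x1 fx1; exists x1.
have [x2 _ rt2] := generically_frequently (generically_nonroot (fy0 y1)) [::].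
rewrite root_swapXY in rt2; exists x2, y1.
have p0 : f.[x1%:P] != 0 by rewrite -size_poly_gt0 fx1.
split=> //.
(* x is kept away from the points whose fibre meets that of x1, so that the
   combination Q below is not zero. *)
have [s def_p] := closed_field_poly_normal f.[x1%:P].
have gs : generically (fun x =>
    forall y, y \in s -> ~~ root (swapXY f).[y%:P] x).
  by apply: generically_all => y _; apply: generically_nonroot.
move=> t; have [x xt [[fxn fx1m] xs]] := frequently_generically fx gs t.
exists x => //; have [y0 rt0] := exroot x fxn.
set p := f.[x1%:P] in p0 def_p rt1 *; set q := f.[x2%:P] in rt2 *.
have py0 : p.[y0] != 0.
  apply: contraL rt0 => py0; rewrite -root_swapXY xs //.
  rewrite -root_prod_XsubC -(rootZ _ _ (_ : lead_coef p != 0)) -?def_p //.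
  by rewrite lead_coef_eq0.
pose Q := p.[y0] *: q - q.[y0] *: p.
have Q0 : Q != 0.
  apply: contraNneq rt2 => /(congr1 (fun h : {poly C} => h.[y1])).
  rewrite !hornerE (rootP rt1) mulr0 subr0 => /eqP.
  by rewrite mulf_eq0 (negPf py0).
have Qroot y : root f.[x%:P] y -> root Q y.
  move=> rty; have /eqpP[[a b] /= /andP[a0 b0] e] := fy x y y0 rty rt0.
  have eE u : a * f.[u%:P].[y] = b * f.[u%:P].[y0].
    have := congr1 (fun h : {poly C} => h.[u]) e.
    by rewrite !hornerZ !horner2_swapXY.
  rewrite /root -(mulrI_eq0 _ (mulfI a0)) !hornerE.
  have -> : a * (p.[y0] * q.[y] - q.[y0] * p.[y]) =
    p.[y0] * (a * q.[y]) - q.[y0] * (a * p.[y]) by ring.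
  by rewrite !eE -/p -/q; apply/eqP; ring.
have h0 : f.[x%:P] != 0 by rewrite -size_poly_gt0 fxn.
have [s' def_h] := closed_field_poly_normal f.[x%:P].
have hE : f.[x%:P] %= \prod_(z <- s') ('X - z%:P).
  by rewrite {1}def_h eqp_scale ?lead_coef_eq0.
have mem_s' z : (z \in s') = root f.[x%:P] z.
  by rewrite (eqp_root hE) root_prod_XsubC.
have fQ : f.[x%:P] %| Q.
  rewrite (eqp_dvdl _ hE); apply: uniq_roots_dvdp.
    by apply/allP => z; rewrite mem_s'; exact: Qroot.
  rewrite uniq_rootsE; apply: count_mem_uniq => z.
  rewrite -mu_prod_XsubC -(eqp_mup _ h0 hE) mem_s'.
  by have [/fx1m|/mupNroot] := boolP (root _ z).
have sQ : size f.[x%:P] == size Q.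
  rewrite eqn_leq dvdp_leq //= fxn.
  apply: leq_trans (size_polyD _ _) _; rewrite size_polyN geq_max.
  by rewrite !(leq_trans (size_scale_leq _ _)) //
    (leq_trans (max_size_evalC _ _)).
rewrite (dvdp_size_eqp fQ) in sQ; move/eqpP: sQ.
move=> [[a b] /= /andP[a0 b0] e].
exists (- (a^-1 * b * q.[y0])), (a^-1 * b * p.[y0]).
rewrite -[LHS]scale1r -(mulVf a0) -scalerA e /Q scalerBr scalerBr !scalerA.
by rewrite addrC scaleNr.
Qed.
End Powers.

(** * Zeros on the sphere and slices of a correspondence *)

Section Slices.
Variable R : realType.
Local Notation C := R[i].
Implicit Types (f g h : {poly {poly C}}) (p q : {poly C}) (a b : option C).
Implicit Types (m n : nat).

Lemma zerosE p : p = lead_coef p *: \prod_(z <- zeros p) ('X - z%:P).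
Proof. by rewrite /zeros; case: closed_field_poly_normal. Qed.

Lemma mem_zeros p z : p != 0 -> (z \in zeros p) = root p z.
Proof.
by move=> p0; rewrite {2}(zerosE p) rootZ ?lead_coef_eq0 // root_prod_XsubC.
Qed.

Lemma size_zeros p : p != 0 -> size (zeros p) = (size p).-1.
Proof.
move=> p0; rewrite {2}(zerosE p) size_scale ?lead_coef_eq0 //.
by rewrite size_prod_XsubC.
Qed.

Lemma perm_zeros p q : p != 0 -> q != 0 ->
  perm_eq (zeros p) (zeros q) = (p %= q).
Proof.
move=> p0 q0; have p_prod : p %= \prod_(z <- zeros p) ('X - z%:P).
  by rewrite {1}(zerosE p) eqp_scale ?lead_coef_eq0.
have q_prod : q %= \prod_(z <- zeros q) ('X - z%:P).
  by rewrite {1}(zerosE q) eqp_scale ?lead_coef_eq0.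
apply/idP/idP => [pq|pq].
  by apply: (eqp_trans p_prod); rewrite (perm_big _ pq) eqp_sym.
apply: prod_XsubC_eq; apply/eqP; rewrite -eqp_monic ?monic_prod_XsubC //.
by rewrite -(eqp_ltrans p_prod) -(eqp_rtrans q_prod).
Qed.

Lemma Some_sphere_zeros n p z : p != 0 ->
  (Some z \in sphere_zeros n p) = root p z.
Proof.
move=> p0; rewrite mem_cat (mem_map Some_inj) mem_zeros //.
by rewrite mem_nseq andbF orbF.
Qed.

Lemma None_sphere_zeros n p :
  (None \in sphere_zeros n p) = (size p <= n)%N.
Proof.
rewrite mem_cat mem_nseq eqxx andbT subn_gt0 ltnS.
by case: mapP => // -[].
Qed.

(** The multiplicity of infinity is determined by the finite zeros, through the
    degree, so the lists coincide exactly for proportional polynomials. *)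
Lemma perm_sphere_zeros n p q : p != 0 -> q != 0 ->
  perm_eq (sphere_zeros n p) (sphere_zeros n q) = (p %= q).
Proof.
move=> p0 q0; have pmap_zeros r : pmap id (sphere_zeros n r) = zeros r.
  rewrite /sphere_zeros pmap_cat.
  by elim: (_ - _)%N => [|k] //=; elim: zeros => //= ? ? ->.
apply/idP/idP => [/(perm_pmap id)|pq].
  by rewrite !pmap_zeros perm_zeros.
rewrite /sphere_zeros (eqp_size pq) perm_cat2r; apply: perm_map.
by rewrite perm_zeros.
Qed.

Lemma slice_Some n f z : (size f <= n.+1)%N -> slice n f (Some z) = f.[z%:P].
Proof.
move=> fn; rewrite (horner_coef_wide _ fn); apply: eq_bigr => i _.
by rewrite /= expr1n mulr1 mulrC -polyC_exp mul_polyC.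
Qed.

Lemma slice_None n f : slice n f None = f`_n.
Proof.
rewrite /slice big_ord_recr /= subnn expr0 expr1n mulr1 scale1r.
rewrite big1 ?add0r // => i _; rewrite expr0n subn_eq0 leqNgt ltn_ord.
by rewrite mulr0 scale0r.
Qed.

Lemma size_slice n f a : (size (slice n f a) <= sizeY f)%N.
Proof.
apply: leq_trans (size_sum _ _ _) _; apply/bigmax_leqP => i _.
exact: leq_trans (size_scale_leq _ _) (max_size_coefXY f i).
Qed.

Lemma bihom_swapXY m n f a b : bihom n m (swapXY f) b a = bihom m n f a b.
Proof.
rewrite /bihom; under eq_bigr do rewrite coef_sum mulr_suml.
under [RHS]eq_bigr do rewrite coef_sum mulr_suml.
rewrite exchange_big; apply: eq_bigr => i _; apply: eq_bigr => j _.
by rewrite !coefZ coef_swapXY; ring.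
Qed.

Lemma mem_fibre n f a b : slice n f a != 0 -> sizeY f = n.+1 ->
  (b \in fibre n f a) = (bihom n n f a b == 0).
Proof.
move=> fa0 fY; have fan := size_slice n f a; rewrite fY in fan.
case: b => [z|]; rewrite /bihom /=.
  rewrite Some_sphere_zeros // rootE (horner_coef_wide _ fan).
  by congr (_ == 0); apply: eq_bigr => i _; rewrite expr1n mulr1.
rewrite None_sphere_zeros big_ord_recr /= subnn expr1n !mulr1 big1 ?add0r.
  apply/idP/eqP => [|fan0]; first exact: nth_default.
  apply/leq_sizeP => j; rewrite leq_eqVlt => /predU1P[<-//|].
  exact/leq_sizeP.
by move=> i _; rewrite expr0n subn_eq0 leqNgt ltn_ord !mulr0.
Qed.

End Slices.

(** * Fibral lines, and roots of correspondences *)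

Section Correspondence.
Local Open Scope classical_set_scope.
Variable R : realType.
Local Notation C := R[i].
Implicit Types (f g h : {poly {poly C}}) (p q : {poly C}) (a b : option C).
Implicit Types (m n : nat) (Z W : set (option C * option C)).

Definition swap_set Z : set (option C * option C) := [set P | Z (P.2, P.1)].

Lemma swap_setK : involutive swap_set.
Proof. by move=> Z; apply/seteqP; split=> -[]. Qed.

Lemma swap_setS Z W : Z `<=` W -> swap_set Z `<=` swap_set W.
Proof. by move=> ZW P; apply: ZW. Qed.

Lemma swap_set_subl Z W : swap_set Z `<=` W -> Z `<=` swap_set W.
Proof. by move=> /swap_setS; rewrite swap_setK. Qed.

Lemma zariski_closed_swap Z : zariski_closed Z -> zariski_closed (swap_set Z).
Proof.
case=> S ->; exists [set u | S (u.1.2, u.1.1, swapXY u.2)].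
apply/seteqP; split=> -[a b] /= SP m n h Sh.
  by rewrite -bihom_swapXY; apply: SP.
by rewrite -bihom_swapXY; apply: SP; rewrite /= swapXYK.
Qed.

Lemma zariski_irreducible_swap Z :
  zariski_irreducible Z -> zariski_irreducible (swap_set Z).
Proof.
case=> -[[a b] Zab] irrZ; split=> [|A B cA cB ZAB]; first by exists (b, a).
have [|/swap_setS|/swap_setS] := irrZ _ _ (zariski_closed_swap cA)
    (zariski_closed_swap cB).
- by move=> [x y] Zxy; have := ZAB (y, x) Zxy.
- by rewrite swap_setK; left.
- by rewrite swap_setK; right.
Qed.

Lemma irreducible_component_swap W Z :
  irreducible_component W Z ->
  irreducible_component (swap_set W) (swap_set Z).
Proof.
case=> WZ irrW maxW; split; first exact: swap_setS.
  exact: zariski_irreducible_swap.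
move=> W' /swap_setS; rewrite swap_setK => W'Z irrW' /swap_set_subl WW'.
by rewrite -(maxW (swap_set W')) ?swap_setK //; exact: zariski_irreducible_swap.
Qed.

Lemma Gamma_swapXY n f : Gamma n (swapXY f) = swap_set (Gamma n f).
Proof.
by apply/seteqP; split=> -[a b]; rewrite /Gamma /swap_set /= bihom_swapXY.
Qed.

Lemma polynomial_correspondence_swapXY n f :
  polynomial_correspondence n f -> polynomial_correspondence n (swapXY f).
Proof.
case=> n0 fX fY gX gY vert horiz; split; rewrite ?swapXYK //.
- by rewrite -sizeYE.
- by rewrite sizeYE swapXYK.
- move=> a; rewrite Gamma_swapXY => /irreducible_component_swap.
  rewrite swap_setK => Wa; apply: (horiz a); congr irreducible_component: Wa.
  by apply/seteqP; split=> -[x y] [].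
- move=> a; rewrite Gamma_swapXY => /irreducible_component_swap.
  rewrite swap_setK => Wa; apply: (vert a); congr irreducible_component: Wa.
  by apply/seteqP; split=> -[x y] [].
Qed.

Lemma bihom_Some m n h a z :
  bihom m n h a (Some z) = (\poly_(j < n.+1) (slice m h a)`_j).[z].
Proof.
by rewrite horner_poly; apply: eq_bigr => j _; rewrite /= expr1n mulr1.
Qed.

(** A binary form with infinitely many zeros vanishes identically; the
    resulting dichotomy is what makes lines irreducible. *)
Lemma line_sub_closed A a : zariski_closed A ->
  [set a] `*` setT `<=` A \/ generically (fun z => ~ A (a, Some z)).
Proof.
case=> S ->; have [|] := pselect ([set a] `*` setT `<=`
  [set P | forall m n h, S (m, n, h) -> bihom m n h P.1 P.2 = 0]).
  by left.
move=> nsub; right.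
have [[[m n] h] [b [Sh hb]]] :
    exists u b, S u /\ bihom u.1.1 u.1.2 u.2 a b <> 0.
  apply: contrapT => nex; apply: nsub => -[_ b] [/= -> _] m n h Sh /=.
  by apply: contrapT => hb; apply: nex; exists (m, n, h), b.
have p0 : \poly_(j < n.+1) (slice m h a)`_j != 0.
  apply/eqP => p0; apply: hb; apply: big1 => j _.
  have := congr1 (fun p : {poly C} => p`_j) p0.
  by rewrite coef_poly ltn_ord coef0 /= => ->; rewrite mul0r.
move: p0 => /generically_nonroot; apply: generically_impl => z nz /(_ m n h Sh).
by rewrite /= bihom_Some => /rootP; exact/negP.
Qed.

Lemma line_irreducible a : zariski_irreducible ([set a] `*` setT).
Proof.
split=> [|A B cA cB AB]; first by exists (a, None).
have [?|nA] := line_sub_closed a cA; first by left.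
have [?|nB] := line_sub_closed a cB; first by right.
have /generically_frequently/(_ [::])[z _ [nAz nBz]] := generically_and nA nB.
by have [] := AB (a, Some z) (conj erefl I).
Qed.

(** A line in the zero set is detected on its finite points. *)
Lemma slice_eq0_of_line m n h a : (sizeY h <= n.+1)%N ->
  (forall b, bihom m n h a b = 0) -> slice m h a = 0.
Proof.
move=> hn hb; apply: contrapT => /eqP/generically_nonroot.
move=> /generically_frequently/(_ [::])[z _ /negP[]]; apply/rootP.
have ha : (size (slice m h a) <= n.+1)%N := leq_trans (size_slice _ _ _) hn.
rewrite -(hb (Some z)) (horner_coef_wide _ ha).
by apply: eq_bigr => j _; rewrite /= expr1n mulr1.
Qed.

Lemma zariski_closed_vertical (z : C) :
  zariski_closed ([set Some z] `*` [set: option C]).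
Proof.
exists [set (1%N, 0%N, 'X - z%:P%:P)]; apply/seteqP; split=> [[_ b] [/= -> _]|].
  move=> _ _ _ [-> -> ->] /=; apply: big1 => j _.
  by rewrite slice_Some ?size_XsubC // hornerXsubC subrr coef0 mul0r.
move=> [a b] /(_ _ _ _ erefl) /=; rewrite /bihom big_ord1 !expr0 !mulr1.
case: a => [w|]; last first.
  rewrite slice_None coefB coefX coefC /= subr0 coef1 => /eqP.
  by rewrite oner_eq0.
rewrite slice_Some ?size_XsubC // hornerXsubC coefB !coefC /= => /eqP.
by rewrite subr_eq0 => /eqP->.
Qed.

Lemma zariski_closed_zeros m n h :
  zariski_closed [set P | bihom m n h P.1 P.2 = 0].
Proof.
exists [set (m, n, h)]; apply/seteqP; split=> P /= hP; last exact: hP.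
by move=> _ _ _ [-> -> ->].
Qed.

(** If the slice at x = z vanishes, write f = (x - z)^e h with the slice of h
    at z not zero.  The zero set of f is then covered by the line x = z and the
    zero set of h.  An irreducible set containing the line lies in one of the
    two, and the second does not contain the line; so the line is an irreducible
    component.  The slice at infinity is the leading coefficient. *)
Lemma correspondence_slice_neq0 n f a :
  polynomial_correspondence n f -> slice n f a != 0.
Proof.
case=> n0 fX fY _ _ vert _; have f0 : f != 0 by rewrite -size_poly_gt0 fX.
case: a => [z|]; last first.
  by rewrite slice_None -[n]/n.+1.-1 -fX -lead_coefE lead_coef_eq0.
rewrite slice_Some ?fX //; apply/eqP => fz0; apply: (vert (Some z)).
have [e [h]] := multiplicity_XsubC f z%:P; rewrite f0 /= => hz def_f.
have h0 : h != 0 by apply: contra_neq f0 => h0; rewrite def_f h0 mul0r.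
have fX' : n = ((size h).-1 + e)%N.
  apply: succn_inj; rewrite -fX def_f size_Mmonic ?monic_exp ?monicXsubC //.
  rewrite size_exp_XsubC addnS /=.
  by rewrite -[size h]prednK ?size_poly_gt0.
have hY : (sizeY h <= n.+1)%N.
  rewrite -fY !sizeYE def_f rmorphM /= size_mul ?swapXY_eq0 //.
    rewrite -subn1 -addnBA ?leq_addr // size_poly_gt0 swapXY_eq0.
    by rewrite expf_neq0 // polyXsubC_eq0.
  by rewrite expf_neq0 // polyXsubC_eq0.
set k := (size h).-1 in fX'.
have hk : (size h <= k.+1)%N by rewrite leqSpred.
have fE x b : bihom n n f x b =
    (if x is Some w then (w - z) ^+ e else 1) * bihom k n h x b.
  rewrite mulr_sumr; apply: eq_bigr => j _; rewrite [RHS]mulrA; congr (_ * _).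
  case: x => [w|].
    rewrite !slice_Some ?fX // def_f hornerM horner_exp hornerXsubC.
    by rewrite -polyCB -polyC_exp coefMC mulrC.
  rewrite !slice_None mul1r.
  have -> : f`_n = lead_coef f by rewrite lead_coefE fX.
  by rewrite def_f lead_coef_Mmonic // monic_exp // monicXsubC.
have GammaE : Gamma n f `<=`
    [set Some z] `*` setT `|` [set P | bihom k n h P.1 P.2 = 0].
  move=> [[w|] b]; rewrite /Gamma /= fE; last by rewrite mul1r; right.
  move/eqP; rewrite mulf_eq0 expf_eq0 subr_eq0.
  by case/orP => [/andP[_ /eqP->]|/eqP]; [left|right].
split; last 1 first.
- move=> W' W'f irrW' lW'; apply/seteqP; split=> //.
  have [_ /(_ _ _ (zariski_closed_vertical z) (zariski_closed_zeros k n h))] :=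
    irrW'.
  case=> //; first exact: subset_trans GammaE.
  move=> W'h; case/eqP: hz; rewrite -(slice_Some _ hk).
  apply: (@slice_eq0_of_line _ n) => // b.
  by apply: (W'h (Some z, b)); apply: lW'.
- move=> [_ b] [/= -> _]; rewrite /Gamma /= /bihom slice_Some ?fX // fz0.
  by apply: big1 => j _; rewrite coef0 mul0r.
- exact: line_irreducible.
Qed.

Lemma slice_power m k g a : (0 < m)%N -> size g = k.+1 ->
  slice (k * m)%N (g ^+ m) a = slice k g a ^+ m.
Proof.
move=> m0 gk; have g0 : g != 0 by rewrite -size_poly_gt0 gk.
have gm : size (g ^+ m) = (k * m).+1.
  rewrite -[k]/k.+1.-1 -gk -size_exp prednK //.
  by rewrite size_poly_gt0 expf_neq0.
case: a => [z|]; first by rewrite !slice_Some ?gm ?gk // horner_exp.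
rewrite !slice_None -[(k * m)%N]/(k * m).+1.-1 -gm -[k]/k.+1.-1 -gk.
by rewrite -!lead_coefE lead_coef_exp.
Qed.

Lemma no_vertical_component n f a : slice n f a != 0 -> sizeY f = n.+1 ->
  ~ irreducible_component ([set a] `*` setT) (Gamma n f).
Proof.
move=> fa0 fY [line _ _]; case/eqP: fa0; apply: (@slice_eq0_of_line _ n).
  by rewrite fY.
by move=> b; apply: (line (a, b)).
Qed.

Lemma generically_valued_root m n g : (0 < m)%N ->
  generically_valued (n * m)%N (g ^+ m) -> generically_valued n g.
Proof.
move=> m0 [s gs]; exists s => a /gs; rewrite horner_exp.
case=> gm0; have g0 : g.[a%:P] != 0.
  by apply: contra_neq gm0 => ->; rewrite expr0n eqn0Ngt m0.
by rewrite !size_zeros // size_exp => /eqP; rewrite eqn_pmul2r // => /eqP.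
Qed.

(** A root inherits all the conditions: degrees are divided by m, and the slices
    of f are the m-th powers of those of g, so that none of the latter
    vanishes. *)
Lemma polynomial_correspondence_root m d f g : (0 < m)%N ->
  polynomial_correspondence d f -> f = g ^+ m ->
  polynomial_correspondence (size g).-1 g /\ d = ((size g).-1 * m)%N.
Proof.
move=> m0 pcf def_f; have pcf' := polynomial_correspondence_swapXY pcf.
have slice0 a := correspondence_slice_neq0 a pcf.
have slice0' a := correspondence_slice_neq0 a pcf'.
case: pcf => d0 fX fY gX gY _ _.
have f0 : f != 0 by rewrite -size_poly_gt0 fX.
have g0 : g != 0.
  by apply: contra_neq f0; rewrite def_f => ->; rewrite expr0n eqn0Ngt m0.
have dE : d = ((size g).-1 * m)%N by rewrite -size_exp -def_f fX.
set k := (size g).-1 in dE *.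
have gS : size g = k.+1 by rewrite prednK // size_poly_gt0.
have k0 : (0 < k)%N by move: d0; rewrite dE muln_gt0 => /andP[].
have gS' : size (swapXY g) = k.+1.
  rewrite -[LHS]prednK ?size_poly_gt0 ?swapXY_eq0 //; congr _.+1.
  apply/eqP; rewrite -(eqn_pmul2r m0) -size_exp -rmorphXn -def_f -dE.
  by rewrite /= -sizeYE fY.
have gslice a : slice k g a != 0.
  apply: contra_neq (slice0 a) => ga.
  by rewrite dE def_f slice_power // ga expr0n eqn0Ngt m0.
have gslice' a : slice k (swapXY g) a != 0.
  apply: contra_neq (slice0' a) => ga.
  by rewrite dE def_f rmorphXn /= slice_power // ga expr0n eqn0Ngt m0.
split=> //; split=> //; first by rewrite sizeYE.
- by apply: (generically_valued_root m0); rewrite -dE -def_f.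
- by apply: (generically_valued_root m0); rewrite -dE -rmorphXn -def_f.
- by move=> a; apply: no_vertical_component; rewrite // sizeYE.
- move=> a /irreducible_component_swap; rewrite -Gamma_swapXY => comp.
  apply: (@no_vertical_component k (swapXY g) a); rewrite ?sizeYE ?swapXYK //.
  congr irreducible_component: comp.
  by apply/seteqP; split=> -[x y] [].
Qed.

Lemma lists_coincideP n f : polynomial_correspondence n f ->
  lists_coincide n f <->
  forall x y y', bihom n n f x y = 0 -> bihom n n f x y' = 0 ->
    slice n (swapXY f) y %= slice n (swapXY f) y'.
Proof.
move=> pcf; have pcf' := polynomial_correspondence_swapXY pcf.
have s0 a := correspondence_slice_neq0 a pcf.
have s0' a := correspondence_slice_neq0 a pcf'.
have fY := corr_degy pcf.
split=> co x y y'.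
  move=> /eqP xy /eqP xy'; rewrite -(perm_sphere_zeros n) //.
  by rewrite (co x) ?mem_fibre.
rewrite !mem_fibre // => /eqP xy /eqP xy'.
by rewrite perm_sphere_zeros //; apply: (co x).
Qed.

Lemma lists_coincide_power k m g : (0 < m)%N ->
  polynomial_correspondence k g ->
  polynomial_correspondence (k * m)%N (g ^+ m) ->
  lists_coincide (k * m)%N (g ^+ m) <-> lists_coincide k g.
Proof.
move=> m0 pcg pcf; have [k0 gX gY _ _ _ _] := pcg.
have gs0 a := correspondence_slice_neq0 a pcg.
have fs0 a := correspondence_slice_neq0 a pcf.
have mem_power x y : (bihom (k * m) (k * m) (g ^+ m) x y == 0) =
    (bihom k k g x y == 0).
  rewrite -!mem_fibre ?(corr_degy pcf) // /fibre slice_power //.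
  have gm0 : slice k g x ^+ m != 0 by rewrite expf_neq0.
  case: y => [z|].
    by rewrite !Some_sphere_zeros // rootE horner_exp expf_eq0 m0.
  rewrite !None_sphere_zeros.
  rewrite -[size (slice k g x ^+ m)]prednK ?size_poly_gt0 // size_exp.
  by rewrite -[size (slice k g x)]prednK ?size_poly_gt0 // ltn_pmul2r.
have eqp_power y y' : (slice (k * m) (swapXY (g ^+ m)) y %=
    slice (k * m) (swapXY (g ^+ m)) y') =
    (slice k (swapXY g) y %= slice k (swapXY g) y').
  have gX' := corr_degx (polynomial_correspondence_swapXY pcg).
  rewrite rmorphXn /= !slice_power //.
  by rewrite /eqp !dvdp_pexp2r.
rewrite !lists_coincideP //; split=> co x y y' /eqP xy /eqP xy'.
  by rewrite -eqp_power; apply: (co x); apply/eqP; rewrite mem_power.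
by rewrite eqp_power; apply: (co x); apply/eqP; rewrite -mem_power.
Qed.

Lemma map_of_tuples_power k m g : (0 < m)%N ->
  polynomial_correspondence k g ->
  polynomial_correspondence (k * m)%N (g ^+ m) ->
  map_of_tuples (k * m)%N (g ^+ m) <-> map_of_tuples k g.
Proof.
move=> m0 pcg pcf; have pcg' := polynomial_correspondence_swapXY pcg.
have pcf' := polynomial_correspondence_swapXY pcf.
rewrite rmorphXn /= in pcf'.
have co := lists_coincide_power m0 pcg pcf.
have co' := lists_coincide_power m0 pcg' pcf'.
by rewrite /map_of_tuples rmorphXn; split=> -[_ /co ? /co' ?].
Qed.

End Correspondence.

(** * Coefficient matrices of rank two *)

Section Rank.
Variable R : realType.
Local Notation C := R[i].
Implicit Types (f g h : {poly {poly C}}) (p q : {poly C}) (a b : option C).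
Implicit Types (m n : nat).

(** The descending order of the exponents is that of [coef_matrix]. *)
Definition monomial_row n a : 'rV[C]_n.+1 :=
  \row_r ((hcoord a).1 ^+ (n - r) * (hcoord a).2 ^+ r).

Definition coef_row n p : 'rV[C]_n.+1 := \row_c p`_(n - c).

Lemma reindex_rev n (V : nmodType) (F : nat -> V) :
  \sum_(i < n.+1) F i = \sum_(r < n.+1) F (n - r)%N.
Proof. by rewrite (reindex_inj rev_ord_inj). Qed.

Lemma coef_row_slice n f a :
  coef_row n (slice n f a) = monomial_row n a *m coef_matrix n f.
Proof.
apply/rowP => c; rewrite !mxE coef_sum.
rewrite (reindex_rev _ (fun i =>
  (((hcoord a).1 ^+ i * (hcoord a).2 ^+ (n - i)) *: f`_i)`_(n - c))).
apply: eq_bigr => r _; rewrite !mxE coefZ.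
by rewrite subKn // -ltnS.
Qed.

Lemma bihom_coef_row n f a b :
  bihom n n f a b = (coef_row n (slice n f a) *m (monomial_row n b)^T) 0 0.
Proof.
rewrite mxE /bihom (reindex_rev _ (fun j =>
  (slice n f a)`_j * ((hcoord b).1 ^+ j * (hcoord b).2 ^+ (n - j)))).
by apply: eq_bigr => r _; rewrite !mxE subKn // -ltnS.
Qed.

Lemma coef_row_eq0 n p : (size p <= n.+1)%N -> (coef_row n p == 0) = (p == 0).
Proof.
move=> pn; apply/eqP/eqP => [p0|->]; last first.
  by apply/rowP => c; rewrite !mxE coef0.
apply/polyP => j; rewrite coef0; have [nj|jn] := ltnP n j.
  by rewrite nth_default // (leq_trans pn).
have := congr1 (fun v : 'rV_n.+1 => v 0 (inord (n - j)%N)) p0.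
by rewrite !mxE inordK ?subKn // ltnS leq_subr.
Qed.

Lemma coef_rowZ n c p : coef_row n (c *: p) = c *: coef_row n p.
Proof. by apply/rowP => j; rewrite !mxE coefZ. Qed.

Lemma coef_rowD n p q : coef_row n (p + q) = coef_row n p + coef_row n q.
Proof. by apply/rowP => j; rewrite !mxE coefD. Qed.

Lemma coef_matrix_swapXY n f :
  coef_matrix n (swapXY f) = (coef_matrix n f)^T.
Proof. by apply/matrixP => r c; rewrite !mxE coef_swapXY. Qed.

(** In a row space of dimension two, a linear form that is not identically zero
    has a kernel of dimension at most one. *)
Lemma proportional_of_rank2 (F : fieldType) n (M : 'M[F]_n) (x u v : 'rV[F]_n) :
  \rank M = 2%N -> M *m x^T != 0 ->
  (u <= M)%MS -> (v <= M)%MS -> u *m x^T = 0 -> v *m x^T = 0 -> u != 0 ->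
  exists c, v = c *: u.
Proof.
move=> rM Mx uM vM ux vx u0; apply/sub_rVP.
have BM : (col_mx u v <= M)%MS by rewrite col_mx_sub uM.
have rB : (\rank (col_mx u v) <= 1)%N.
  rewrite -ltnS ltn_neqAle (rank_leq_row (col_mx u v)) andbT.
  apply: contra_neqN Mx => /eqP rB.
  have /submxP[D ->] : (M <= col_mx u v)%MS.
    by rewrite -(geq_leqif (mxrank_leqif_sup BM)) rM rB.
  by rewrite -mulmxA mul_col_mx ux vx col_mx0 mulmx0.
have uB : (u <= col_mx u v)%MS by rewrite -addsmxE addsmxSl.
apply: submx_trans (_ : (col_mx u v <= u)%MS).
  by rewrite -addsmxE addsmxSr.
rewrite -(geq_leqif (mxrank_leqif_sup uB)) (leq_trans rB) //.
by rewrite lt0n mxrank_eq0.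
Qed.

Lemma lists_coincide_of_rank2 n f : polynomial_correspondence n f ->
  \rank (coef_matrix n f) = 2%N -> lists_coincide n f.
Proof.
move=> pcf rf; apply/(lists_coincideP pcf) => x y y' xy xy'.
have pcf' := polynomial_correspondence_swapXY pcf.
have size_s g a :
    polynomial_correspondence n g -> (size (slice n g a) <= n.+1)%N.
  by move=> pcg; rewrite (leq_trans (size_slice _ _ _)) ?(corr_degy pcg).
have sub z : (coef_row n (slice n (swapXY f) z) <= coef_matrix n (swapXY f))%MS.
  by rewrite coef_row_slice submxMl.
have van z : bihom n n f x z = 0 ->
    coef_row n (slice n (swapXY f) z) *m (monomial_row n x)^T = 0.
  move=> xz; apply/rowP => j; rewrite ord1 -bihom_coef_row bihom_swapXY xz.
  by rewrite mxE.
have [|||c e] :=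
  proportional_of_rank2 _ _ (sub y) (sub y') (van y xy) (van y' xy').
- by rewrite coef_matrix_swapXY mxrank_tr.
- rewrite coef_matrix_swapXY -trmx_mul -coef_row_slice trmx_eq0.
  by rewrite coef_row_eq0 ?correspondence_slice_neq0 ?size_s.
- by rewrite coef_row_eq0 ?correspondence_slice_neq0 ?size_s.
have /eqP := e; rewrite -coef_rowZ -subr_eq0 -scaleN1r -coef_rowZ -coef_rowD.
rewrite coef_row_eq0; last first.
  rewrite (leq_trans (size_polyD _ _)) // geq_max size_s // scalerA.
  by rewrite (leq_trans (size_scale_leq _ _)) ?size_s.
rewrite scaleN1r subr_eq0 => /eqP def_y'.
have c0 : c != 0.
  have := correspondence_slice_neq0 y' pcf'.
  by apply: contra_neq => c0; rewrite def_y' c0 scale0r.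
by rewrite def_y' eqp_sym eqp_scale.
Qed.

(** The rows of M lie in the span of the two given slices as soon as infinitely
    many slices do: an equation of that span, applied to f(x, .), is a
    polynomial in x with infinitely many zeros. *)
Lemma rank2_of_pencil n f x1 x2 y1 :
    (size f <= n.+1)%N -> (sizeY f <= n.+1)%N ->
    f.[x1%:P] != 0 -> root f.[x1%:P] y1 -> ~~ root f.[x2%:P] y1 ->
    frequently (fun x => exists a b : C,
      f.[x%:P] = a *: f.[x1%:P] + b *: f.[x2%:P]) ->
  \rank (coef_matrix n f) = 2%N.
Proof.
move=> fX fY p0 py1 qy1 pencil; set p := f.[x1%:P] in p0 py1 pencil *.
set q := f.[x2%:P] in qy1 pencil; set M := coef_matrix n f.
have sz x : (size f.[x%:P] <= n.+1)%N.
  exact: leq_trans (max_size_evalC _ _) fY.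
pose B := col_mx (coef_row n p) (coef_row n q).
have rowM x : coef_row n f.[x%:P] = monomial_row n (Some x) *m M.
  by rewrite -coef_row_slice slice_Some.
have BM : (B <= M)%MS by rewrite col_mx_sub !rowM !submxMl.
have MB : (M <= B)%MS.
  rewrite submxE; set K := cokermx B.
  have BK : B *m K = 0 by apply: mulmx_coker.
  move: BK; rewrite mul_col_mx -[RHS]col_mx0 => /eq_col_mx[pK qK].
  apply/eqP/matrixP => r c; rewrite [RHS]mxE.
  pose P := \poly_(i < n.+1) (M *m K) (inord (n - i)) c.
  suff P0 : P = 0.
    have := congr1 (fun h : {poly C} => h`_(n - r)) P0.
    rewrite coef_poly ltnS leq_subr coef0 subKn ?inord_val //.
    by rewrite -ltnS.
  apply: contrapT => /eqP/generically_nonroot.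
  move=> /(frequently_generically pencil)/(_ [::])[x _ [[a [b xE]] /negP[]]].
  have xK : monomial_row n (Some x) *m (M *m K) = 0.
    rewrite mulmxA -rowM xE coef_rowD !coef_rowZ mulmxDl -!scalemxAl pK qK.
    by rewrite !scaler0 addr0.
  have := congr1 (fun v : 'rV_n.+1 => v 0 c) xK; rewrite mxE [RHS]mxE => xc.
  apply/rootP; rewrite -[RHS]xc horner_poly.
  rewrite (reindex_rev _ (fun i => (M *m K) (inord (n - i)) c * x ^+ i)).
  apply: eq_bigr => i _; rewrite subKn ?inord_val; last by rewrite -ltnS.
  by rewrite [monomial_row _ _ _ _]mxE /= expr1n mulr1 mulrC.
have -> : \rank M = \rank B by apply/eqP; rewrite eqn_leq !mxrankS.
apply/eqP; change (row_free B); rewrite -kermx_eq0; apply/eqP/row_matrixP => i.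
rewrite row0; set v := row i _.
have vB : v *m B = 0 by rewrite -row_mul mulmx_ker row0.
move: vB; rewrite -(hsubmxK v) mul_row_col.
rewrite [lsubmx v]mx11_scalar [rsubmx v]mx11_scalar.
set a := lsubmx v 0 0; set b := rsubmx v 0 0.
rewrite !mul_scalar_mx -!coef_rowZ -coef_rowD => /eqP.
have Zsz (t : C) x : (size (t *: f.[x%:P]) <= n.+1)%N.
  exact: leq_trans (size_scale_leq _ _) (sz x).
rewrite coef_row_eq0; last first.
  by rewrite (leq_trans (size_polyD _ _)) // geq_max !Zsz.
move=> /eqP abE; have b0 : b = 0.
  have := congr1 (fun h : {poly C} => h.[y1]) abE.
  rewrite !hornerE (rootP py1) mulr0 add0r => /eqP.
  by rewrite mulf_eq0 (negPf (qy1 : q.[y1] != 0)) orbF => /eqP.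
move: abE; rewrite b0 scale0r addr0 => /eqP.
rewrite scaler_eq0 (negPf p0) orbF => /eqP ->.
by rewrite !raddf0 row_mx0.
Qed.

End Rank.

(** * Fibres of uniform multiplicity *)

Section Main.
Variable R : realType.
Local Notation C := R[i].
Implicit Types (f g h : {poly {poly C}}) (p q : {poly C}) (x y : C).
Implicit Types (m n : nat).

Lemma correspondence_horner_neq0 n f x :
  polynomial_correspondence n f -> f.[x%:P] != 0.
Proof.
move=> pcf; rewrite -(@slice_Some _ n) ?(corr_degx pcf) //.
exact: correspondence_slice_neq0.
Qed.

Lemma generically_full_degree n f : polynomial_correspondence n f ->
  generically (fun x => size f.[x%:P] = n.+1).
Proof.
move=> pcf; have [s sP] := corr_valx pcf; exists s => x /sP[fx0].
by rewrite size_zeros // => <-; rewrite prednK // size_poly_gt0.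
Qed.

Lemma lists_coincide_horner n f x y y' :
  polynomial_correspondence n f -> lists_coincide n f ->
  root f.[x%:P] y -> root f.[x%:P] y' ->
  (swapXY f).[y%:P] %= (swapXY f).[y'%:P].
Proof.
move=> pcf /(lists_coincideP pcf) co.
have pcf' := polynomial_correspondence_swapXY pcf.
have bihomE t : root f.[x%:P] t -> bihom n n f (Some x) (Some t) = 0.
  move=> rt; apply/eqP; rewrite -mem_fibre ?(corr_degy pcf) //.
    rewrite Some_sphere_zeros slice_Some ?(corr_degx pcf) //.
    exact: correspondence_horner_neq0 pcf.
  exact: correspondence_slice_neq0.
move=> /bihomE xy /bihomE xy'; have := co _ _ _ xy xy'.
by rewrite !slice_Some ?(corr_degx pcf').
Qed.

(** Prescribing both multiplicities is what carries m from the points x to the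
    points y of their fibres. *)
Definition uniform_fibre m f x := forall y, root f.[x%:P] y ->
  mup y f.[x%:P] = m /\ mup x (swapXY f).[y%:P] = m.

(** The multiplicity of x in the list of y is independent of y in the fibre of
    x, because these lists coincide; generically it is also the multiplicity of
    y in the fibre of x. *)
Lemma generically_uniform_fibre n f :
  polynomial_correspondence n f -> lists_coincide n f ->
  generically (fun x => exists m, uniform_fibre m f x).
Proof.
move=> pcf co; have pcf' := polynomial_correspondence_swapXY pcf.
have f0 : f != 0 by rewrite -size_poly_gt0 (corr_degx pcf).
have [A [B AB]] := agree_multiplicity f0.
have gB : generically (fun x =>
    forall y, y \in B -> ~~ root (swapXY f).[y%:P] x).
  apply: generically_all => y _; apply: generically_nonroot.
  exact: correspondence_horner_neq0 pcf'.
apply: generically_impl (generically_and gB (generically_notin A)) => x [xB xA].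
have mupE y : root f.[x%:P] y -> mup y f.[x%:P] = mup x (swapXY f).[y%:P].
  move=> rxy; have yB : y \notin B.
    by apply: contraL rxy => /xB; rewrite root_swapXY.
  by have [] := AB x y xA yB.
have [[y0 rxy0]|nrx] := pselect (exists y, root f.[x%:P] y); last first.
  by exists 0%N => y rxy; case: nrx; exists y.
exists (mup x (swapXY f).[y0%:P]) => y rxy; rewrite mupE //.
suff -> : mup x (swapXY f).[y%:P] = mup x (swapXY f).[y0%:P] by [].
apply: eqp_mup (lists_coincide_horner pcf co rxy rxy0).
exact: correspondence_horner_neq0 pcf'.
Qed.

Lemma frequently_uniform_fibre n f :
  polynomial_correspondence n f -> lists_coincide n f ->
  exists2 m, (0 < m)%N & frequently (fun x => uniform_fibre m f x).
Proof.
move=> pcf co; have n0 := corr_pos pcf.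
suff: exists2 m, (m < n.+1)%N &
    frequently (fun x => (0 < m)%N /\ uniform_fibre m f x).
  move=> [m _ fm]; have [_ _ [m0 _]] := fm [::].
  by exists m => // s; have [x xs [_ ux]] := fm s; exists x.
apply: frequently_pigeonhole; apply: generically_frequently.
have := generically_and (generically_full_degree pcf)
  (generically_uniform_fibre pcf co).
apply: generically_impl => x [sx [m um]].
have fx0 := correspondence_horner_neq0 x pcf.
have [y rxy] : exists y, root f.[x%:P] y.
  by apply/closed_rootP; rewrite sx -(prednK n0).
have [mE _] := um y rxy; exists m.
  rewrite -mE mup_ltn //; apply/negP => /dvdp_leq.
  by rewrite size_exp_XsubC sx ltnn => /(_ fx0).
by split=> //; rewrite -mE -XsubC_dvd // dvdp_XsubCl.
Qed.

(** For a generic x of multiplicity m, each y in its fibre is generic too, and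
    its fibre has the multiplicity of the point x in it, which is m. *)
Lemma frequently_uniform_fibre_swapXY m n f :
  polynomial_correspondence n f -> lists_coincide n (swapXY f) ->
  frequently (fun x => uniform_fibre m f x) ->
  frequently (fun y => uniform_fibre m (swapXY f) y).
Proof.
move=> pcf co' fm s; have pcf' := polynomial_correspondence_swapXY pcf.
have [E EP] := generically_uniform_fibre pcf' co'.
have gE : generically (fun x => size f.[x%:P] = n.+1 /\
    forall y, y \in s ++ E -> ~~ root (swapXY f).[y%:P] x).
  apply: generically_and; first exact: generically_full_degree.
  apply: generically_all => y _; apply: generically_nonroot.
  exact: correspondence_horner_neq0 pcf'.
have [x _ [um [sx xE]]] := frequently_generically fm gE [::].
have [y rxy] : exists y, root f.[x%:P] y.
  by apply/closed_rootP; rewrite sx -(prednK (corr_pos pcf)).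
have : y \notin s ++ E by apply: contraL rxy => /xE; rewrite root_swapXY.
rewrite mem_cat negb_or => /andP[ys /EP[m' um']]; exists y => //.
have [_ mE] := um y rxy.
have ryx : root (swapXY f).[y%:P] x by rewrite root_swapXY.
by have [m'E _] := um' x ryx; rewrite -mE m'E.
Qed.

Lemma map_of_tuples_dichotomy n f : map_of_tuples n f ->
  (exists m g, [/\ (1 < m)%N & f = g ^+ m]) \/ \rank (coef_matrix n f) = 2%N.
Proof.
case=> pcf co co'; have pcf' := polynomial_correspondence_swapXY pcf.
have [m m0 fm] := frequently_uniform_fibre pcf co.
have [m1|m1] := leqP m 1; [right|left].
  have {}m1 : m = 1%N by apply/eqP; rewrite eqn_leq m1.
  rewrite {}m1 {m0} in fm *.
  have [|||||x1 [x2 [y1 [p0 py1 qy1 pencil]]]] :=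
    @pencil_of_simple_fibres _ n f.
  - exact: corr_pos pcf.
  - by rewrite (corr_degy pcf).
  - by move=> y; exact: correspondence_horner_neq0 pcf'.
  - by move=> x y y'; exact: lists_coincide_horner pcf co.
  - move=> s; have [x xs [ux sx]] :=
      frequently_generically fm (generically_full_degree pcf) s.
    by exists x => //; split=> // y /ux[].
  by apply: rank2_of_pencil p0 py1 qy1 pencil;
    rewrite ?(corr_degx pcf) ?(corr_degy pcf).
have fpow g : polynomial_correspondence n g ->
    frequently (fun x => uniform_fibre m g x) ->
    frequently (fun x => exists r, g.[x%:P] = r ^+ m).
  move=> pcg gm s; have [x xs ux] := gm s; exists x => //.
  apply: power_of_uniform_mup => //.
    exact: correspondence_horner_neq0 pcg.
  by move=> y /ux[].
have fm' := frequently_uniform_fibre_swapXY pcf co' fm.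
have [g gE] := power_of_slices m0 (fpow f pcf fm) (fpow _ pcf' fm').
by exists m, g.
Qed.

End Main.

Unset Implicit Arguments.

Theorem theorem2p4 (R : realType) (d : nat) (hd : (2 <= d)%N)
    (f : {poly {poly R[i]}}) (hf : polynomial_correspondence d f) :
  map_of_tuples d f <->
  (exists (k : nat) (g : {poly {poly R[i]}}),
      [/\ (k %| d)%N, k <> d, map_of_tuples k g & f = g ^+ (d %/ k)%N]) \/
  \rank (coef_matrix d f) = 2%N.
Proof.
split=> [mapf|[[k [g [kd kd' mapg def_f]]]|rf]].
- have [[m [g [m1 def_f]]]|] := map_of_tuples_dichotomy mapf; last by right.
  have m0 := ltnW m1; left.
  have [pcg dE] := polynomial_correspondence_root m0 hf def_f.
  have k0 := corr_pos pcg; set k := (size g).-1 in pcg dE k0.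
  exists k, g; split.
  + by rewrite dE dvdn_mulr.
  + by apply/eqP; rewrite dE -{1}[k]muln1 eqn_pmul2l // ltn_eqF.
  + rewrite dE def_f in hf mapf.
    exact: (map_of_tuples_power m0 pcg hf).1.
  + by rewrite dE mulKn.
- have [pcg _ _] := mapg; have k0 := corr_pos pcg.
  have m0 : (0 < d %/ k)%N by rewrite divn_gt0 // dvdn_leq // ltnW.
  have dE : d = (k * (d %/ k))%N by rewrite mulnC divnK.
  move: m0 dE def_f hf; set m := (d %/ k)%N => m0 -> -> hf.
  exact: (map_of_tuples_power m0 pcg hf).2.
- have hf' := polynomial_correspondence_swapXY hf.
  split=> //; apply: lists_coincide_of_rank2 => //.
  by rewrite coef_matrix_swapXY mxrank_tr.
Qed.
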